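(* Let $ABC$ be a triangle and let $P$ be a point with isotomic conjugate $P'=\iota(P)$ with respect to $ABC$, such that $P$ and $P'$ are ordinary and do not lie on the (extended) sides or medians of the triangles $ABC$ and $K^{-1}(ABC)$, and suppose that the point $H=K^{-1}(O)$ does not coincide with a vertex of $ABC$. Then the following are equivalent: (1) $\mathsf{M}=T_P\circ K^{-1}\circ T_{P'}$ is a half-turn; (2) $P$ lies on $\tilde{\mathcal{C}}_{O'}$; (3) $P'$ lies on $\tilde{\mathcal{C}}_{O}$; (4) $T_P(P)=O'$; (5) $T_{P'}(P')=O$; (6) $O'$ lies on $\mathcal{N}_P$; (7) $O$ lies on $\mathcal{N}_{P'}$.
   Context: We work in the real affine plane, extended by the line at infinity $l_\infty$ to the real projective plane; a point is ordinary if it is not on $l_\infty$. Sides and medians are extended to lines. $G$ is the centroid of $ABC$; $K$ is the complement map, i.e. the homothety with center $G$ and ratio $-\tfrac12$, so $K^{-1}(ABC)$ is the anticomplementary triangle. $\iota$ is the isotomic map of $ABC$: in homogeneous barycentric coordinates $\iota(x:y:z)=(1/x:1/y:1/z)$. Put $Q=K(P')$ and $Q'=K(P)$. The cevian triangle of $P$ with respect to $ABC$ is $DEF$ with $D=AP\cdot BC$, $E=BP\cdot CA$, $F=CP\cdot AB$ (the dot denotes intersection of lines). $T_P$ is the unique affine map with $A\mapsto D,\ B\mapsto E,\ C\mapsto F$, and $T_{P'}$ is the unique affine map taking $A,B,C$ to the corresponding vertices of the cevian triangle of $P'$. $\mathcal{N}_P$ (resp. $\mathcal{N}_{P'}$)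 is the nine-point conic of the quadrangle $ABCP$ (resp. $ABCP'$) relative to $l_\infty$: the conic through the three diagonal points and the midpoints of the six sides of the quadrangle; equivalently, the locus of centers of the conics through the four vertices of the quadrangle. Define the circumconics $\tilde{\mathcal{C}}_O=T_{P'}^{-1}(\mathcal{N}_{P'})$ and $\tilde{\mathcal{C}}_{O'}=T_P^{-1}(\mathcal{N}_P)$; their centers are $O=T_{P'}^{-1}(K(Q))$ and $O'=T_P^{-1}(K(Q'))$ respectively. A half-turn is a point reflection, i.e. a homothety of ratio $-1$ about an ordinary point.
   Formalization: The implication from (6) to the other conditions is proved only when H' = K^{-1}(O') is not a vertex of ABC; without this it is false, e.g. for P = (1:3:2), where O' is the midpoint of BC, so (6) holds and (1) fails. *)

(* Defs.v *)
From mathcomp Require Import all_boot all_order all_algebra.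
From mathcomp Require Import boolp classical_sets reals.

Set Implicit Arguments.
Unset Strict Implicit.
Unset Printing Implicit Defensive.

Import Order.TTheory GRing.Theory Num.Theory.
Local Open Scope classical_set_scope.
Local Open Scope ring_scope.

Section AffinePlane.
Variable R : realType.

(* The ordinary points of the extended plane. *)
Definition plane := 'rV[R]_2.

Implicit Types (A B C P X Y U V W S : plane) (f T : plane -> plane).

(* Meaningful for X <> Y; degenerates to [set X] otherwise. *)
Definition line X Y : set plane := [set X + t *: (Y - X) | t in [set: R]].

Definition midpoint X Y : plane := 2^-1 *: (X + Y).

Definition triangle A B C : Prop := B <> C /\ ~ line B C A.

(* The complement map sends the vertices to the midpoints of the sides, which
   lie on every nine-point conic of ABC and a fourth point; so for a vertex S the
   condition that K(S) is on such a conic is void. *)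
Definition vertices A B C : set plane := [set A; B; C].

Definition sides A B C : set plane := line B C `|` line C A `|` line A B.

Definition medians A B C : set plane :=
  line A (midpoint B C) `|` line B (midpoint C A) `|` line C (midpoint A B).

Definition centroid A B C : plane := 3^-1 *: (A + B + C).

Definition homothety S (k : R) X : plane := S + k *: (X - S).

Definition complement A B C : plane -> plane :=
  homothety (centroid A B C) (- 2^-1).

(* K^-1, the homothety with the same center and the inverse ratio. *)
Definition anticomplement A B C : plane -> plane :=
  homothety (centroid A B C) (- 2).

Definition half_turn f : Prop := exists S, f =1 homothety S (-1).

(* X is the ordinary point with homogeneous barycentric coordinates
   (x : y : z); a triple with x + y + z = 0 represents no ordinary point. *)
Definition barycentric A B C (x y z : R) X : Prop :=
  x + y + z != 0 /\ (x + y + z) *: X = x *: A + y *: B + z *: C.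

(* P' is the isotomic conjugate of P, and both points are ordinary. *)
Definition isotomic A B C P P' : Prop :=
  exists x y z : R, [/\ x != 0, y != 0, z != 0,
    barycentric A B C x y z P & barycentric A B C x^-1 y^-1 z^-1 P'].

Definition affine f : Prop :=
  exists (L : 'M[R]_2) (b : plane), forall X, f X = X *m L + b.

Definition cevian_triangle A B C P D E F : Prop :=
  [/\ line A P `&` line B C = [set D],
      line B P `&` line C A = [set E] &
      line C P `&` line A B = [set F]].

(* T is the affine map taking ABC to the cevian triangle of P. *)
Definition cevian_map A B C P T : Prop :=
  affine T /\ cevian_triangle A B C P (T A) (T B) (T C).

(* The ordinary points of the conic h *m q *m h^T = 0, where h = (X, 1) are
   homogeneous coordinates; q != 0 and symmetry are imposed in is_conic. *)
Definition conic_locus (q : 'M[R]_(2 + 1)) : set plane :=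
  [set X | row_mx X (1%:M : 'M[R]_1) *m q *m (row_mx X (1%:M : 'M[R]_1))^T = 0].

Definition is_conic (N : set plane) : Prop :=
  exists q : 'M[R]_(2 + 1), [/\ q^T = q, q != 0 & N = conic_locus q].

Definition diagonal_points A B C P : set plane :=
  (line A P `&` line B C) `|` (line B P `&` line C A) `|`
  (line C P `&` line A B).

Definition side_midpoints A B C P : set plane :=
  [set midpoint B C; midpoint C A; midpoint A B;
       midpoint A P; midpoint B P; midpoint C P].

(* The conic through the nine points, as a set. For P off the sides and medians
   of ABC and of its anticomplementary triangle exactly one conic passes through
   them, and the existential picks it. *)
Definition nine_point_conic A B C P : set plane :=
  [set X | exists N : set plane,
    [/\ is_conic N, diagonal_points A B C P `<=` N,
        side_midpoints A B C P `<=` N & N X]].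

End AffinePlane.

(* Main.v *)
Require Import Defs.
From mathcomp Require Import all_boot all_order all_algebra.
From mathcomp Require Import boolp classical_sets reals.
From mathcomp Require Import ring lra.

Set Implicit Arguments.
Unset Strict Implicit.
Unset Printing Implicit Defensive.

Import Order.TTheory GRing.Theory Num.Theory.
Local Open Scope classical_set_scope.
Local Open Scope ring_scope.

(** Everything is computed in barycentric coordinates.  Let P = (x : y : z), so
P' = (1/x : 1/y : 1/z), and put a = y + z, b = z + x, c = x + y.  The
hypothesis that P avoids the sides and medians of ABC and of its
anticomplementary triangle says that x, y, z, a, b, c and the differences
y - z, z - x, x - y are nonzero.  Each condition of the theorem turns out to
say that P lies on one cubic curve, abc = 4xyz; this equation is unchanged when
x, y, z are replaced by their inverses, which accounts for the symmetry
between P and P'.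

- The linear part of M is always a scalar: the matrix of T_P o T_P' differs
  from 2xyz/(abc) times the identity by a matrix with three equal columns.
  Hence the linear part of M = T_P o K^-1 o T_P' is -4xyz/(abc)
  ([cevian_composite]), and M is a half-turn exactly when this scalar is -1.
- The nine-point conic has the explicit equation [nine_point_form]
  ([nine_point_conic_bary]): the six points lying on the sidelines of ABC
  already determine the equation up to a factor.  Its value at T_P(P) is
  abc - 4xyz up to a nonzero factor ([conic_image_P]).
- T_P(P) = O' means T_P(T_P(P)) = K(K(P)).  The first coordinates of the two
  sides differ by a nonzero multiple of (2x - a)(abc - 4xyz), and similarly for
  the others; 2x = a and 2y = b cannot both hold, since they give x = y
  ([image_P_center]).
- Let U = x(x+y+z) - yz and V, W similarly.  Then O' = (a^2 U : b^2 V : c^2 W)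
  and H' = (VW : WU : UV), and the equation of N_P at O' has the value
  -2(x+y+z) UVW (abc - 4xyz).  If U = 0, then H' = A; so when H' is not a
  vertex, O' lies on N_P only if abc = 4xyz ([center_on_conic]).

The statements on P' are the same lemmas applied to (1/x : 1/y : 1/z). *)

Section Barycentric.
Variables (R : realType) (A B C : plane R).
Implicit Types (x y z X Y Z : R).

(** * Barycentric coordinates *)

Definition bary x y z : plane R :=
  (x + y + z)^-1 *: (x *: A + y *: B + z *: C).

Lemma barycentricE x y z P :
  barycentric A B C x y z P -> x + y + z != 0 /\ P = bary x y z.
Proof. by case=> s0 e; split=> //; rewrite /bary -e scalerA mulVf ?scale1r. Qed.

Lemma affine_bary T x y z : affine T -> x + y + z != 0 ->
  T (bary x y z) = (x + y + z)^-1 *: (x *: T A + y *: T B + z *: T C).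
Proof.
case=> L [b eT] s0; rewrite !eT /bary.
rewrite -scalemxAl !mulmxDl -!scalemxAl; apply/rowP => i; rewrite !mxE; field.
exact: s0.
Qed.

Lemma complement_bary x y z : x + y + z != 0 ->
  complement A B C (bary x y z) = bary (y + z) (z + x) (x + y).
Proof.
move=> s0; apply/rowP => i; rewrite !mxE; field.
have -> : y + z + (z + x) + (x + y) = 2 * (x + y + z) by ring.
by rewrite mulf_neq0 ?pnatr_eq0 // s0.
Qed.

Lemma anticomplement_bary x y z : x + y + z != 0 ->
  anticomplement A B C (bary x y z) = bary (y + z - x) (z + x - y) (x + y - z).
Proof.
move=> s0; apply/rowP => i; rewrite !mxE; field.
have -> : y + z - x + (z + x - y) + (x + y - z) = x + y + z by ring.
by rewrite s0.
Qed.

Hypothesis tABC : triangle A B C.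

Lemma barycentric_independent x y z :
  x + y + z = 0 -> x *: A + y *: B + z *: C = 0 -> [/\ x = 0, y = 0 & z = 0].
Proof.
move=> s0 e0; case: tABC => nBC nA.
have ey : y = - x - z by lra.
have x0 : x = 0.
  apply/eqP/negPn/negP => x0; apply: nA; exists (- z / x) => //.
  apply: (scalerI x0); apply/eqP; rewrite eq_sym -subr_eq0; apply/eqP.
  rewrite -{}e0 {}ey; apply/rowP => i; rewrite !mxE; field; exact: x0.
subst x; have ez : y = - z by lra.
suff z0 : z = 0 by rewrite ez z0 oppr0.
apply/eqP/negPn/negP => z0; apply: nBC; apply: (scalerI z0); apply/eqP.
rewrite eq_sym -subr_eq0; apply/eqP; rewrite -{}e0 {}ez.
by apply/rowP => i; rewrite !mxE; ring.
Qed.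

Lemma bary_eq x y z X Y Z : x + y + z != 0 -> X + Y + Z != 0 ->
  bary x y z = bary X Y Z <->
  [/\ x * (X + Y + Z) = X * (x + y + z), y * (X + Y + Z) = Y * (x + y + z)
    & z * (X + Y + Z) = Z * (x + y + z)].
Proof.
move=> s0 S0; split=> [e|[ex ey ez]].
  have [||] := @barycentric_independent (x * (X + Y + Z) - X * (x + y + z))
    (y * (X + Y + Z) - Y * (x + y + z)) (z * (X + Y + Z) - Z * (x + y + z)).
  - by ring.
  - have {}e : bary x y z - bary X Y Z = 0 by rewrite e subrr.
    apply: etrans (_ : ((x + y + z) * (X + Y + Z)) *:
                       (bary x y z - bary X Y Z) = 0).
      by apply/rowP => i; rewrite !mxE; field; rewrite S0 s0.
    by rewrite e scaler0.
  - by move=> /subr0_eq ex /subr0_eq ey /subr0_eq ez.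
have sc : (x + y + z) *: (X *: A + Y *: B + Z *: C) =
    (X + Y + Z) *: (x *: A + y *: B + z *: C).
  by rewrite !scalerDr !scalerA ![(x + y + z) * _]mulrC -ex -ey -ez
    ![_ * (X + Y + Z)]mulrC.
apply: (scalerI s0); apply: (scalerI S0).
by rewrite /bary !scalerA mulfK // [(X + Y + Z) * _]mulrC mulfK.
Qed.

Definition bvec x y z : 'rV[R]_3 := \row_i [:: x; y; z]`_i.

Definition homog (X : plane R) : 'rV[R]_(2 + 1) := row_mx X (1%:M : 'M[R]_1).

(** The homogeneous coordinates (X, 1) of a point are obtained from its
barycentric coordinates through the matrix whose rows are the homogeneous
coordinates of A, B, C.  It is invertible because ABC is a triangle, so it
transports conics between the two coordinate systems in both directions. *)
Definition vertex_mx : 'M[R]_3 := \matrix_i homog [:: A; B; C]`_i.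

Lemma row_mx_inj (u v : plane R) (s t : R) :
  row_mx u (s%:M : 'M[R]_1) = row_mx v t%:M -> u = v /\ s = t.
Proof.
by case/eq_row_mx=> -> /matrixP/(_ 0 0); rewrite !mxE eqxx !mulr1n.
Qed.

Lemma bvec_vertex_mx x y z :
  bvec x y z *m vertex_mx = row_mx (x *: A + y *: B + z *: C) (x + y + z)%:M.
Proof.
rewrite mulmx_sum_row !big_ord_recl big_ord0 !rowK !mxE /= addr0 addrA.
have -> : (x + y + z)%:M = x *: 1%:M + y *: 1%:M + z *: 1%:M :> 'M[R]_1.
  by rewrite !scale_scalar_mx !mulr1 !rmorphD.
have sumE : x *: homog A + y *: homog B + z *: homog C =
    row_mx (x *: A + y *: B + z *: C) (x *: 1%:M + y *: 1%:M + z *: 1%:M).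
  apply/rowP => i; rewrite !mxE; case: splitP => j _; by rewrite !mxE.
exact: sumE.
Qed.

Lemma homog_bary x y z : x + y + z != 0 ->
  homog (bary x y z) = (x + y + z)^-1 *: (bvec x y z *m vertex_mx).
Proof.
move=> s0; rewrite bvec_vertex_mx; apply: etrans (esym (scale_row_mx _ _ _)).
by rewrite scale_scalar_mx mulVf.
Qed.

Lemma bvec_ex (u : 'rV[R]_3) : exists x y z, u = bvec x y z.
Proof.
exists (u 0 0), (u 0 1), (u 0 2); apply/rowP => i; rewrite mxE.
by case: i => [[|[|[|//]]] /= p]; congr (u _ _); apply: val_inj.
Qed.

Lemma vertex_mx_unit : vertex_mx \in unitmx.
Proof.
rewrite -row_free_unit; apply: inj_row_free => u.
have [x [y [z ->]]] := bvec_ex u; rewrite bvec_vertex_mx => e.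
have [e0 s0] : x *: A + y *: B + z *: C = 0 /\ x + y + z = 0.
  apply: row_mx_inj; rewrite raddf0.
  exact: etrans e (esym (row_mx0 R 1 2 1)).
have [-> -> ->] := barycentric_independent s0 e0.
by apply/rowP => i; rewrite !mxE; case: i => [[|[|[|//]]] p].
Qed.

Lemma bary_surj (X : plane R) :
  exists x y z, x + y + z = 1 /\ X = bary x y z.
Proof.
have [x [y [z e]]] := bvec_ex (homog X *m invmx vertex_mx).
have := mulmxKV vertex_mx_unit (homog X); rewrite e bvec_vertex_mx.
move=> /row_mx_inj[eX s1].
by exists x, y, z; split=> //; rewrite /bary s1 invr1 scale1r eX.
Qed.

(** * Conics in barycentric coordinates *)

Definition quad (q : 'M[R]_3) x y z := (bvec x y z *m q *m (bvec x y z)^T) 0 0.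

Lemma quadE q x y z : q^T = q -> quad q x y z =
  q 0 0 * x ^+ 2 + q 1 1 * y ^+ 2 + q 2 2 * z ^+ 2 +
  2 * (q 1 2 * (y * z) + q 2 0 * (z * x) + q 0 1 * (x * y)).
Proof.
move=> qT; have qC i j : q i j = q j i by rewrite -{1}qT mxE.
rewrite /quad !mxE !big_ord_recl big_ord0 !mxE !big_ord_recl !big_ord0 !mxE /=.
have -> : lift ord0 ord0 = 1 :> 'I_3 by apply: val_inj.
have -> : lift ord0 (lift ord0 ord0) = 2 :> 'I_3 by apply: val_inj.
have -> : ord0 = 0 :> 'I_3 by [].
rewrite (qC 1 0) (qC 2 1) (qC 0 2); ring.
Qed.

Lemma conic_locus_bary q x y z : x + y + z != 0 ->
  conic_locus q (bary x y z) <->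
  quad (vertex_mx *m q *m vertex_mx^T) x y z = 0.
Proof.
move=> s0; rewrite /conic_locus /= -/(homog _) homog_bary // /quad.
set u := bvec x y z *m vertex_mx.
have -> : bvec x y z *m (vertex_mx *m q *m vertex_mx^T) *m (bvec x y z)^T =
   u *m q *m u^T by rewrite /u trmx_mul !mulmxA.
rewrite linearZ /= -scalemxAr -!scalemxAl scalerA; split=> [/eqP|e].
  rewrite scaler_eq0 mulf_eq0 invr_eq0 (negPf s0) /= => /eqP e.
  by rewrite e mxE.
rewrite [u *m q *m _]mx11_scalar e.
by apply/rowP => i; rewrite !mxE mul0rn mulr0.
Qed.

(** * Points off the sides and medians *)

Definition generic x y z := [/\ [&& x != 0, y != 0 & z != 0],
  [&& y + z != 0, z + x != 0 & x + y != 0],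
  [&& y != z, z != x & x != y] & x + y + z != 0].

Lemma median_bary x y :
  x + 2 * y != 0 -> [/\ line A (midpoint B C) (bary x y y),
    line B (midpoint C A) (bary y x y) & line C (midpoint A B) (bary y y x)].
Proof.
have s2 : 2 != 0 :> R by rewrite pnatr_eq0.
have line_mid (U V W : plane R) t : t + 2 * y != 0 ->
    line U (midpoint V W) ((t + 2 * y)^-1 *: (t *: U + y *: V + y *: W)).
  move=> t0; exists (2 * y / (t + 2 * y)) => //.
  by apply/rowP => i; rewrite !mxE; field.
move=> s0; rewrite /bary; split.
- have -> : x + y + y = x + 2 * y by ring.
  exact: line_mid.
- have -> : y + x + y = x + 2 * y by ring.
  rewrite -[_ + y *: C]addrA [y *: A + _]addrC; exact: line_mid.
- have -> : y + y + x = x + 2 * y by ring.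
  rewrite [_ + x *: C]addrC addrA; exact: line_mid.
Qed.

Lemma anticomplement_side_bary x y (K := anticomplement A B C) :
  x != 0 -> [/\ line (K B) (K C) (bary x y (- y)),
    line (K C) (K A) (bary (- y) x y) & line (K A) (K B) (bary y (- y) x)].
Proof.
move=> x0; split; exists ((1 + y / x) / 2) => //;
  apply/rowP => i; rewrite !mxE; field;
  by rewrite ?addrK ?subrr ?[- y + x]addrC ?subrK ?add0r.
Qed.

(** y = z puts P on the median through A, and y + z = 0 puts it on the parallel
to BC through A, which is a side of the anticomplementary triangle. *)
Lemma generic_of_not_excluded x y z (K := anticomplement A B C) :
  [/\ x != 0, y != 0 & z != 0] -> x + y + z != 0 ->
  ~ (sides A B C `|` medians A B C `|` sides (K A) (K B) (K C)
    `|` medians (K A) (K B) (K C)) (bary x y z) ->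
  generic x y z.
Proof.
case=> x0 y0 z0 s0 ex; split; rewrite ?x0 ?y0 ?z0 ?s0 //.
- apply/and3P; split; apply/negP; rewrite addr_eq0 => /eqP e; apply: ex;
    left; right.
  + left; left; have [+ _ _] := anticomplement_side_bary (- z) x0.
    by rewrite opprK e.
  + left; right; have [_ + _] := anticomplement_side_bary (- x) y0.
    by rewrite opprK e.
  + right; have [_ _] := anticomplement_side_bary (- y) z0.
    by rewrite opprK e.
- apply/and3P; split; apply/negP => /eqP e; apply: ex; left; left; right.
  + left; left; have [] // := @median_bary x z; last by rewrite e.
    by move: s0; rewrite e mulr2n mulrDl mul1r addrA.
  + left; right; have [] // := @median_bary y x; last by rewrite e.
    move: s0; rewrite e; congr (_ != _); ring.
  + right; have [] // := @median_bary z x; last by rewrite e.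
    move: s0; rewrite -e; congr (_ != _); ring.
Qed.

Lemma generic_inv x y z : x^-1 + y^-1 + z^-1 != 0 ->
  generic x y z -> generic x^-1 y^-1 z^-1.
Proof.
move=> s0 [/and3P[x0 y0 z0] /and3P[a0 b0 c0] /and3P[yz zx xy] _].
have sum_inv (u v : R) : u != 0 -> v != 0 -> u + v != 0 -> u^-1 + v^-1 != 0.
  move=> u0 v0 w0; have -> : u^-1 + v^-1 = (u + v) / (u * v).
    by field; rewrite u0 v0.
  by rewrite mulf_neq0 // invr_eq0 mulf_neq0.
split=> //; first by rewrite !invr_eq0 x0 y0.
- by rewrite !sum_inv.
- by rewrite !(inj_eq invr_inj) yz zx.
Qed.

(** * The cevian map *)

Lemma cevian_feet x y z (P := bary x y z) :
  x + y + z != 0 -> [&& y + z != 0, z + x != 0 & x + y != 0] ->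
  [/\ (line A P `&` line B C) (bary 0 y z),
      (line B P `&` line C A) (bary x 0 z) &
      (line C P `&` line A B) (bary x y 0)].
Proof.
move=> s0 /and3P[a0 b0 c0]; rewrite {}/P; split; split.
- exists ((x + y + z) / (y + z)) => //.
  by apply/rowP => i; rewrite !mxE; field;
    rewrite ?add0r ?addr0 ?[x + z]addrC ?a0 ?b0 ?c0 ?s0.
- exists (z / (y + z)) => //.
  by apply/rowP => i; rewrite !mxE; field;
    rewrite ?add0r ?addr0 ?[x + z]addrC ?a0 ?b0 ?c0 ?s0.
- exists ((x + y + z) / (z + x)) => //.
  by apply/rowP => i; rewrite !mxE; field;
    rewrite ?add0r ?addr0 ?[x + z]addrC ?a0 ?b0 ?c0 ?s0.
- exists (x / (z + x)) => //.
  by apply/rowP => i; rewrite !mxE; field;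
    rewrite ?add0r ?addr0 ?[x + z]addrC ?a0 ?b0 ?c0 ?s0.
- exists ((x + y + z) / (x + y)) => //.
  by apply/rowP => i; rewrite !mxE; field;
    rewrite ?add0r ?addr0 ?[x + z]addrC ?a0 ?b0 ?c0 ?s0.
- exists (y / (x + y)) => //.
  by apply/rowP => i; rewrite !mxE; field;
    rewrite ?add0r ?addr0 ?[x + z]addrC ?a0 ?b0 ?c0 ?s0.
Qed.

Lemma cevian_map_vertices x y z T :
  generic x y z -> cevian_map A B C (bary x y z) T ->
  [/\ T A = bary 0 y z, T B = bary x 0 z & T C = bary x y 0].
Proof.
case=> _ h _ s0 [_ [eA eB eC]].
have [] := cevian_feet s0 h; rewrite eA eB eC.
by move=> /= -> -> ->.
Qed.

Lemma cevian_map_bary x y z T X Y Z :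
  generic x y z -> cevian_map A B C (bary x y z) T -> X + Y + Z != 0 ->
  T (bary X Y Z) = bary (x * (Y / (z + x) + Z / (x + y)))
    (y * (X / (y + z) + Z / (x + y))) (z * (X / (y + z) + Y / (z + x))).
Proof.
move=> g cT S0; have [eA eB eC] := cevian_map_vertices g cT.
rewrite affine_bary ?eA ?eB ?eC //; last by case: cT.
case: g => _ /and3P[a0 b0 c0] _ s0.
have e : x * (Y / (z + x) + Z / (x + y)) + y * (X / (y + z) + Z / (x + y)) +
    z * (X / (y + z) + Y / (z + x)) = X + Y + Z.
  by field; rewrite a0 b0 c0.
rewrite [in RHS]/bary e; apply/rowP => i; rewrite !mxE; field.
by rewrite ?add0r ?addr0 ?[x + z]addrC a0 b0 c0 S0.
Qed.

(** The same map for the isotomic conjugate, with the inverses cleared: a foot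
such as (0 : 1/y : 1/z) is (0 : z : y). *)
Lemma isotomic_cevian_map_bary x y z T X Y Z :
  x^-1 + y^-1 + z^-1 != 0 -> generic x y z ->
  cevian_map A B C (bary x^-1 y^-1 z^-1) T -> X + Y + Z != 0 ->
  T (bary X Y Z) = bary (Y * z / (z + x) + Z * y / (x + y))
    (X * z / (y + z) + Z * x / (x + y)) (X * y / (y + z) + Y * x / (z + x)).
Proof.
move=> s'0 g cT S0; rewrite (cevian_map_bary (generic_inv s'0 g) cT) // !mulrDr.
case: g => /and3P[x0 y0 z0] /and3P[a0 b0 c0] _ _.
have inv_ratio (u w p : R) : u != 0 -> w != 0 -> u + w != 0 ->
    u^-1 * (p / (u^-1 + w^-1)) = p * w / (u + w).
  move=> u0 w0 uw0; have -> : u^-1 + w^-1 = (u + w) / (u * w).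
    by field; rewrite u0 w0.
  by field; rewrite u0 w0 uw0.
have := inv_ratio x z Y; have := inv_ratio x y Z.
have := inv_ratio y z X; have := inv_ratio y x Z.
have := inv_ratio z y X; have := inv_ratio z x Y.
rewrite ![x^-1 + z^-1]addrC ![y^-1 + x^-1]addrC ![z^-1 + y^-1]addrC.
rewrite ![x + z]addrC ![y + x]addrC ![z + y]addrC.
by do 6![move=> ->//].
Qed.

(** * The nine-point conic *)

(** The equation of the conic through the feet of the cevians of (x : y : z) and
the midpoints of the sides of ABC.  Divided by xyz, the coefficients are 1/x of
X^2 and -(1/y + 1/z) of YZ: on the sideline X = 0 this leaves
(Y - Z)(Y/y - Z/z). *)
Definition nine_point_form x y z X Y Z : R :=
  y * z * X ^+ 2 + z * x * Y ^+ 2 + x * y * Z ^+ 2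
  - x * (y + z) * (Y * Z) - y * (z + x) * (Z * X) - z * (x + y) * (X * Y).

Lemma side_midpoints_bary x y z (s := x + y + z) :
  s != 0 ->
  [/\ midpoint B C = bary 0 1 1, midpoint C A = bary 1 0 1
    & midpoint A B = bary 1 1 0] /\
  [/\ midpoint A (bary x y z) = bary (s + x) y z,
      midpoint B (bary x y z) = bary x (s + y) z
    & midpoint C (bary x y z) = bary x y (s + z)].
Proof.
rewrite {}/s => s0.
split; split; apply/rowP => i; rewrite !mxE ?add0r ?addr0; field;
  rewrite ?s0 //=.
- have -> : x + y + z + x + y + z = 2 * (x + y + z) by ring.
  by rewrite mulf_neq0 ?pnatr_eq0.
- have -> : x + (x + y + z + y) + z = 2 * (x + y + z) by ring.
  by rewrite mulf_neq0 ?pnatr_eq0.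
- have -> : x + y + (x + y + z + z) = 2 * (x + y + z) by ring.
  by rewrite mulf_neq0 ?pnatr_eq0.
Qed.

Definition sym_mx (a b c d e f : R) : 'M[R]_3 :=
  \matrix_(i, j) (nth [::] [:: [:: a; f; e]; [:: f; b; d]; [:: e; d; c]] i)`_j.

Lemma sym_mx_tr a b c d e f : (sym_mx a b c d e f)^T = sym_mx a b c d e f.
Proof.
by apply/matrixP => -[[|[|[|//]]] i] [[|[|[|//]]] j]; rewrite !mxE.
Qed.

Lemma quad_sym_mx a b c d e f x y z : quad (sym_mx a b c d e f) x y z =
  a * x ^+ 2 + b * y ^+ 2 + c * z ^+ 2 +
  2 * (d * (y * z) + e * (z * x) + f * (x * y)).
Proof. by rewrite quadE ?sym_mx_tr // !mxE. Qed.

Lemma sym_mx_ex q : q^T = q -> exists a b c d e f, q = sym_mx a b c d e f.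
Proof.
move=> qT; have qC i j : q i j = q j i by rewrite -{1}qT mxE.
exists (q 0 0), (q 1 1), (q 2 2), (q 1 2), (q 2 0), (q 0 1).
apply/matrixP => -[[|[|[|//]]] i] [[|[|[|//]]] j]; rewrite !mxE /=;
  first [by congr (q _ _); apply: val_inj
        | by rewrite qC; congr (q _ _); apply: val_inj].
Qed.

(** A conic with two prescribed points on each sideline.  On X = 0, vanishing at
(0 : 1 : 1) and (0 : y : z) forces b y = c z and 2 d = - b - c, which needs
y <> z for the two points to be distinct; together the three sidelines
determine the equation up to the factor k. *)
Lemma six_point_conic x y z a b c d e f :
  [&& x != 0, y != 0 & z != 0] -> [&& y != z, z != x & x != y] ->
  let q X Y Z := a * X ^+ 2 + b * Y ^+ 2 + c * Z ^+ 2 +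
    2 * (d * (Y * Z) + e * (Z * X) + f * (X * Y)) in
  [/\ q 0 1 1 = 0, q 1 0 1 = 0 & q 1 1 0 = 0] ->
  [/\ q 0 y z = 0, q x 0 z = 0 & q x y 0 = 0] ->
  exists k, [/\ a = k * (y * z), b = k * (z * x) & c = k * (x * y)] /\
    [/\ 2 * d = - k * (x * (y + z)), 2 * e = - k * (y * (z + x))
      & 2 * f = - k * (z * (x + y))].
Proof.
move=> /and3P[x0 y0 z0] /and3P[yz zx xy] q [mA mB mC] [fA fB fC].
have by_cz : y * b = z * c.
  apply: (mulfI (_ : y - z != 0)); first by rewrite subr_eq0.
  apply/eqP; rewrite -subr_eq0; apply/eqP.
  transitivity (q 0 y z - y * z * q 0 1 1); first by rewrite /q; ring.
  by rewrite fA mA; ring.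
have cz_ax : z * c = x * a.
  apply: (mulfI (_ : z - x != 0)); first by rewrite subr_eq0.
  apply/eqP; rewrite -subr_eq0; apply/eqP.
  transitivity (q x 0 z - z * x * q 1 0 1); first by rewrite /q; ring.
  by rewrite fB mB; ring.
have eb : b = a * x / y by rewrite [a * x]mulrC -cz_ax -by_cz; field.
have ec : c = a * x / z by rewrite [a * x]mulrC -cz_ax; field.
exists (a / (y * z)); split; split; rewrite /q in mA mB mC.
- by field; rewrite y0 z0.
- by rewrite eb; field; rewrite y0 z0.
- by rewrite ec; field; rewrite y0 z0.
- have -> : 2 * d = - b - c by lra.
  by rewrite eb ec; field; rewrite y0 z0.
- have -> : 2 * e = - a - c by lra.
  by rewrite ec; field; rewrite y0 z0.
- have -> : 2 * f = - a - b by lra.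
  by rewrite eb; field; rewrite y0 z0.
Qed.

(** The conic of the definition exists and is unique, so lying on it is
expressed by one equation.  Uniqueness uses only the three midpoints of the
sides of ABC and the three diagonal points; existence checks all nine points,
the midpoint of A and P being (2x + y + z : y : z). *)
Lemma nine_point_conic_bary x y z T X Y Z :
  generic x y z -> cevian_map A B C (bary x y z) T -> X + Y + Z != 0 ->
  nine_point_conic A B C (bary x y z) (bary X Y Z) <->
  nine_point_form x y z X Y Z = 0.
Proof.
move=> g cT S0; have [eA eB eC] := cevian_map_vertices g cT.
case: cT => _ [lA lB lC]; rewrite eA eB eC in lA lB lC.
case: g => nz /and3P[a0 b0 c0] ne s0.
have [[mA mB mC] [mAP mBP mCP]] := side_midpoints_bary s0.
have two0 : (2 : R) != 0 by rewrite pnatr_eq0.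
have two_s0 : 2 * (x + y + z) != 0 by rewrite mulf_neq0.
have sumA : x + y + z + x + y + z != 0.
  by apply: contraNneq two_s0 => e; rewrite -[X in _ == X]e; apply/eqP; ring.
have sumB : x + (x + y + z + y) + z != 0.
  by apply: contraNneq two_s0 => e; rewrite -[X in _ == X]e; apply/eqP; ring.
have sumC : x + y + (x + y + z + z) != 0.
  by apply: contraNneq two_s0 => e; rewrite -[X in _ == X]e; apply/eqP; ring.
split=> [[N [[q [qT q0 ->]]]]|F0].
- rewrite /diagonal_points lA lB lC => dN mN.
  rewrite conic_locus_bary //.
  set q' := vertex_mx *m q *m vertex_mx^T.
  have q'T : q'^T = q' by rewrite /q' !trmx_mul trmxK qT mulmxA.
  have q'0 : q' != 0.
    apply: contraNneq q0 => e.
    have -> : q = invmx vertex_mx *m q' *m (invmx vertex_mx)^T.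
      rewrite /q' !mulmxA mulVmx ?vertex_mx_unit // mul1mx -mulmxA -trmx_mul.
      by rewrite mulVmx ?vertex_mx_unit // trmx1 mulmx1.
    by rewrite e mulmx0 mul0mx.
  have [a [b [c [d [e [f eq']]]]]] := sym_mx_ex q'T.
  have onN p r t : p + r + t != 0 -> conic_locus q (bary p r t) ->
      a * p ^+ 2 + b * r ^+ 2 + c * t ^+ 2 +
      2 * (d * (r * t) + e * (t * p) + f * (p * r)) = 0.
    by move=> w0 /(conic_locus_bary _ w0); rewrite -/q' eq' quad_sym_mx.
  have [||k [[ea eb ec] [ed ee ef]]] :=
    @six_point_conic x y z a b c d e f nz ne.
  + rewrite /side_midpoints mA mB mC in mN.
    by split; apply: onN; rewrite ?add0r ?addr0 //; apply: mN;
      do ?[by right|left].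
  + by split; apply: onN; rewrite ?add0r ?addr0 // 1?[x + z]addrC //; apply: dN;
      [left; left|left; right|right].
  (* k = 0 would make the equation of the conic identically zero *)
  have k0 : k != 0.
    apply: contraNneq q'0 => k0; rewrite {}k0 oppr0 !mul0r in ea eb ec ed ee ef.
    rewrite eq' ea eb ec.
    move/eqP: ed; rewrite mulf_eq0 (negPf two0) => /eqP ->.
    move/eqP: ee; rewrite mulf_eq0 (negPf two0) => /eqP ->.
    move/eqP: ef; rewrite mulf_eq0 (negPf two0) => /eqP ->.
    by apply/eqP/matrixP => -[[|[|[|//]]] i] [[|[|[|//]]] j]; rewrite !mxE.
  rewrite eq' quad_sym_mx ea eb ec => e0.
  apply: (mulfI k0); rewrite mulr0 -e0 !mulrDr !mulrA ed ee ef /nine_point_form.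
  by ring.
- pose q' := sym_mx (y * z) (z * x) (x * y) (- (x * (y + z)) / 2)
    (- (y * (z + x)) / 2) (- (z * (x + y)) / 2).
  pose q := invmx vertex_mx *m q' *m (invmx vertex_mx)^T.
  have eq' : vertex_mx *m q *m vertex_mx^T = q'.
    rewrite /q !mulmxA mulmxV ?vertex_mx_unit // mul1mx -mulmxA -trmx_mul.
    by rewrite mulmxV ?vertex_mx_unit // trmx1 mulmx1.
  have onN p r t : p + r + t != 0 -> nine_point_form x y z p r t = 0 ->
      conic_locus q (bary p r t).
    move=> w0 e; apply/(conic_locus_bary _ w0); rewrite eq' quad_sym_mx -e.
    by rewrite /nine_point_form; field.
  exists (conic_locus q); split.
  + exists q; split=> //.
      by rewrite /q !trmx_mul trmxK sym_mx_tr mulmxA.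
    apply/eqP => q0; move: eq'; rewrite q0 mulmx0 mul0mx.
    move=> /matrixP/(_ 0 0)/eqP.
    case/and3P: nz => x0 y0 z0.
    by rewrite !mxE /= eq_sym mulf_eq0 (negPf y0) (negPf z0).
  + rewrite /diagonal_points lA lB lC => U [[]|] ->; apply: onN;
      rewrite ?add0r ?addr0 // 1?[x + z]addrC //;
      rewrite /nine_point_form; ring.
  + rewrite /side_midpoints mA mB mC mAP mBP mCP => U [[[[[|]|]|]|]|] ->;
      apply: onN; rewrite ?add0r ?addr0 //; rewrite /nine_point_form; ring.
  + exact: onN.
Qed.

(** * The cubic and the equivalent conditions *)

Definition halfturn_locus x y z : Prop :=
  (y + z) * (z + x) * (x + y) = 4 * (x * y * z).

Lemma halfturn_locus_inv x y z : x != 0 -> y != 0 -> z != 0 ->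
  halfturn_locus x^-1 y^-1 z^-1 <-> halfturn_locus x y z.
Proof.
move=> x0 y0 z0; rewrite /halfturn_locus.
have -> : (y^-1 + z^-1) * (z^-1 + x^-1) * (x^-1 + y^-1) =
    (y + z) * (z + x) * (x + y) / (x * y * z) ^+ 2.
  by field; rewrite x0 y0 z0.
have -> : 4 * (x^-1 * y^-1 * z^-1) = 4 * (x * y * z) / (x * y * z) ^+ 2.
  by field; rewrite x0 y0 z0.
split=> [|-> //]; apply: mulIf.
by rewrite invr_eq0 expf_eq0 /= !mulf_neq0.
Qed.

(** With s = x + y + z, the equation of the nine-point conic at T(P) has the
value -2xyz s (abc - 4xyz) / (abc). *)
Lemma conic_image_P x y z T :
  generic x y z -> cevian_map A B C (bary x y z) T ->
  nine_point_conic A B C (bary x y z) (T (bary x y z)) <-> halfturn_locus x y z.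
Proof.
move=> g cT; have := g.
case=> /and3P[x0 y0 z0] /and3P[a0 b0 c0] _ s0.
rewrite (cevian_map_bary g cT s0).
rewrite (nine_point_conic_bary g cT); last first.
  apply: contraNneq s0 => e; rewrite -e; apply/eqP; field.
  by rewrite a0 b0 c0.
have -> : nine_point_form x y z (x * (y / (z + x) + z / (x + y)))
  (y * (x / (y + z) + z / (x + y))) (z * (x / (y + z) + y / (z + x))) =
  (-2 * (x * y * z) * (x + y + z) / ((y + z) * (z + x) * (x + y))) *
  ((y + z) * (z + x) * (x + y) - 4 * (x * y * z)).
  rewrite /nine_point_form; field; by rewrite a0 b0 c0.
split=> [/eqP|->]; last by rewrite subrr mulr0.
rewrite !(mulf_eq0, invr_eq0, oppr_eq0) (negPf x0) (negPf y0) (negPf z0).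
rewrite (negPf s0) (negPf a0) (negPf b0) (negPf c0) pnatr_eq0 /= subr_eq0.
by move/eqP.
Qed.

(** The centers O and O' are defined through K(Q) = K(K(P')) and K(K(P)). *)
Lemma complement_twice_bary x y z (K := complement A B C) (s := x + y + z) :
  s != 0 -> K (K (bary x y z)) = bary (s + x) (s + y) (s + z).
Proof.
move=> s0; rewrite /K !complement_bary //.
  by congr bary; rewrite /s; ring.
have -> : y + z + (z + x) + (x + y) = 2 * s by rewrite /s; ring.
by rewrite mulf_neq0 ?pnatr_eq0.
Qed.

Lemma complement_twice_sum x y z (s := x + y + z) :
  s + x + (s + y) + (s + z) = 4 * s.
Proof. by rewrite /s; ring. Qed.

(** Both conditions are compared after applying T, which turns the center into
K(K(P)) without inverting T. *)
Lemma image_P_center x y z T O (K := complement A B C) :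
  generic x y z -> cevian_map A B C (bary x y z) T ->
  T @^-1` [set K (K (bary x y z))] = [set O] ->
  T (bary x y z) = O <-> halfturn_locus x y z.
Proof.
move=> g cT eO; have := g.
case=> /and3P[x0 y0 z0] /and3P[a0 b0 c0] /and3P[yz zx xy] s0.
have -> : (T (bary x y z) = O) <-> T (T (bary x y z)) = K (K (bary x y z)).
  have -> : (T (bary x y z) = O) = [set O] (T (bary x y z)) by [].
  by rewrite -eO.
rewrite /K complement_twice_bary //.
set s := x + y + z in s0 *.
have t1 : x * (y / (z + x) + z / (x + y)) + y * (x / (y + z) + z / (x + y)) +
    z * (x / (y + z) + y / (z + x)) = s.
  by rewrite /s; field; rewrite a0 b0 c0.
rewrite (cevian_map_bary g cT s0) (cevian_map_bary g cT) ?t1 //.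
set u1 := x * _ in t1 *; set u2 := y * _ in t1 *; set u3 := z * _ in t1 *.
set v1 := x * _; set v2 := y * _; set v3 := z * _.
have t2 : v1 + v2 + v3 = s.
  by rewrite -t1 /v1 /v2 /v3; field; rewrite a0 b0 c0.
rewrite bary_eq ?complement_twice_sum ?t2 ?mulf_neq0 ?pnatr_eq0 //.
pose f w := s * (2 * w - (s - w)) / ((y + z) * (z + x) * (x + y)) *
  ((y + z) * (z + x) * (x + y) - 4 * (x * y * z)).
have diff1 : v1 * (4 * s) - (s + x) * s = f x.
  by rewrite /f /v1 /u2 /u3 /s; field; rewrite a0 b0 c0.
have diff2 : v2 * (4 * s) - (s + y) * s = f y.
  by rewrite /f /v2 /u1 /u3 /s; field; rewrite a0 b0 c0.
have diff3 : v3 * (4 * s) - (s + z) * s = f z.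
  by rewrite /f /v3 /u1 /u2 /s; field; rewrite a0 b0 c0.
split=> [[e1 e2 _]|e]; last first.
  by split; apply: subr0_eq; rewrite ?diff1 ?diff2 ?diff3 /f e subrr mulr0.
apply/eqP; rewrite -subr_eq0; apply/negPn/negP => n0.
have f0 w : f w = 0 -> 3 * w = s.
  move/eqP; rewrite /f mulf_eq0 (negPf n0) !mulf_eq0 invr_eq0 !mulf_eq0.
  rewrite (negPf s0) (negPf a0) (negPf b0) (negPf c0) !orbF /= => /eqP; lra.
have ex : 3 * x = s by apply: f0; rewrite -diff1 e1 subrr.
have ey : 3 * y = s by apply: f0; rewrite -diff2 e2 subrr.
by move/eqP: xy; apply; lra.
Qed.

(** The given preimage is a singleton, so it suffices to see that T maps the
point with these coordinates to K(K(P)). *)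
Lemma center_bary x y z T O (K := complement A B C) (s := x + y + z) :
  generic x y z -> cevian_map A B C (bary x y z) T ->
  T @^-1` [set K (K (bary x y z))] = [set O] ->
  O = bary ((y + z) ^+ 2 * (x * s - y * z)) ((z + x) ^+ 2 * (y * s - z * x))
    ((x + y) ^+ 2 * (z * s - x * y)).
Proof.
move=> g cT eO; have := g; rewrite {}/s.
case=> /and3P[x0 y0 z0] /and3P[a0 b0 c0] _ s0.
apply/esym; rewrite -[_ = O]/([set O] _) -eO /=.
have S0 : (y + z) ^+ 2 * (x * (x + y + z) - y * z) +
    (z + x) ^+ 2 * (y * (x + y + z) - z * x) +
    (x + y) ^+ 2 * (z * (x + y + z) - x * y) != 0.
  have -> : (y + z) ^+ 2 * (x * (x + y + z) - y * z) +
    (z + x) ^+ 2 * (y * (x + y + z) - z * x) +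
    (x + y) ^+ 2 * (z * (x + y + z) - x * y) = 8 * (x * y * z) * (x + y + z).
    by ring.
  by rewrite !mulf_neq0 ?pnatr_eq0.
rewrite /K complement_twice_bary // (cevian_map_bary g cT) //.
apply/bary_eq.
- apply: contraNneq S0 => e; rewrite -[X in _ == X]e; apply/eqP; field.
  by rewrite a0 b0 c0.
- by rewrite complement_twice_sum mulf_neq0 ?pnatr_eq0.
- by split; field; rewrite a0 b0 c0.
Qed.

(** M is a translation or a homothety for every P, because the linear part of
T o T' is 2xyz/(abc) and that of K^-1 is -2. *)
Lemma cevian_composite x y z T T' :
  x^-1 + y^-1 + z^-1 != 0 ->
  generic x y z -> cevian_map A B C (bary x y z) T ->
  cevian_map A B C (bary x^-1 y^-1 z^-1) T' ->
  exists v : plane R, forall X : plane R,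
    (T \o anticomplement A B C \o T') X =
    - (4 * (x * y * z) / ((y + z) * (z + x) * (x + y))) *: X + v.
Proof.
move=> s'0 g cT cT'; have := g.
case=> /and3P[x0 y0 z0] /and3P[a0 b0 c0] _ s0.
set r := - _.
exists (x * (y + z) / ((z + x) * (x + y)) *: A +
  y * (z + x) / ((x + y) * (y + z)) *: B +
  z * (x + y) / ((y + z) * (z + x)) *: C) => X.
have [X1 [X2 [X3 [S1 ->]]]] := bary_surj X.
have S0 : X1 + X2 + X3 != 0 by rewrite S1 oner_neq0.
rewrite /= (isotomic_cevian_map_bary s'0 g cT') //.
set u1 := X2 * z / _ + _; set u2 := X1 * z / _ + _; set u3 := X1 * y / _ + _.
have u_sum : u1 + u2 + u3 = 1.
  by rewrite -S1 /u1 /u2 /u3; field; rewrite a0 b0 c0.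
rewrite anticomplement_bary ?u_sum ?oner_neq0 //.
have d_sum : u2 + u3 - u1 + (u3 + u1 - u2) + (u1 + u2 - u3) = 1.
  by rewrite -u_sum; ring.
rewrite (cevian_map_bary g cT) ?d_sum ?oner_neq0 // /bary S1.
set w1 := x * _; set w2 := y * _; set w3 := z * _.
(* the sum of the coordinates, which is 1, makes both sides homogeneous *)
have e1 : w1 = r * X1 + x * (y + z) / ((z + x) * (x + y)) * (X1 + X2 + X3).
  by rewrite /w1 /u1 /u2 /u3 /r; field; rewrite a0 b0 c0.
have e2 : w2 = r * X2 + y * (z + x) / ((x + y) * (y + z)) * (X1 + X2 + X3).
  by rewrite /w2 /u1 /u2 /u3 /r; field; rewrite a0 b0 c0.
have e3 : w3 = r * X3 + z * (x + y) / ((y + z) * (z + x)) * (X1 + X2 + X3).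
  by rewrite /w3 /u1 /u2 /u3 /r; field; rewrite a0 b0 c0.
have w_sum : w1 + w2 + w3 = 1.
  by rewrite -d_sum /w1 /w2 /w3; field; rewrite a0 b0 c0.
rewrite w_sum invr1 !scale1r e1 e2 e3 S1 !mulr1.
by apply/rowP => i; rewrite !mxE; ring.
Qed.

Lemma half_turn_linear_part f r v :
  (forall X : plane R, f X = r *: X + v) -> half_turn f <-> r = -1.
Proof.
move=> ef; split=> [[S hS]|er].
- have := hS B; have := hS C; rewrite !ef /homothety => eC eB.
  have eBC : (r + 1) *: B = (r + 1) *: C.
    apply/eqP; rewrite -subr_eq0; apply/eqP.
    transitivity ((r *: B + v) - (r *: C + v) + (B - C)).
      by apply/rowP => i; rewrite !mxE; ring.
    by rewrite eB eC; apply/rowP => i; rewrite !mxE; ring.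
  apply/eqP; rewrite -addr_eq0; apply/negPn/negP => r0.
  by case: tABC => nBC _; apply: nBC; apply: (scalerI r0).
- exists (2^-1 *: v) => X; rewrite ef er.
  by apply/rowP => i; rewrite !mxE; field.
Qed.

Lemma half_turn_cevian_composite x y z T T' :
  x^-1 + y^-1 + z^-1 != 0 ->
  generic x y z -> cevian_map A B C (bary x y z) T ->
  cevian_map A B C (bary x^-1 y^-1 z^-1) T' ->
  half_turn (T \o anticomplement A B C \o T') <-> halfturn_locus x y z.
Proof.
move=> s'0 g cT cT'; have [v eM] := cevian_composite s'0 g cT cT'.
rewrite (half_turn_linear_part eM) /halfturn_locus.
case: g => _ /and3P[a0 b0 c0] _ _.
have abc0 : (y + z) * (z + x) * (x + y) != 0 by rewrite !mulf_neq0.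
split=> [/oppr_inj e|<-]; last by rewrite divff.
by rewrite -(divfK abc0 (4 * _)) e mul1r.
Qed.

(** The converse direction must exclude UVW = 0, and this is where H' matters:
its coordinates are (VW : WU : UV), so a vanishing U leaves only the
first one, and H' = A. *)
Lemma center_on_conic x y z T O (K := complement A B C) :
  generic x y z -> cevian_map A B C (bary x y z) T ->
  T @^-1` [set K (K (bary x y z))] = [set O] ->
  (halfturn_locus x y z -> nine_point_conic A B C (bary x y z) O) /\
  (~ vertices A B C (anticomplement A B C O) ->
   nine_point_conic A B C (bary x y z) O -> halfturn_locus x y z).
Proof.
move=> g cT eO; rewrite (center_bary g cT eO); have := g.
case=> /and3P[x0 y0 z0] /and3P[a0 b0 c0] _ s0.
set U := x * _ - _; set V := y * _ - _; set W := z * _ - _.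
set o1 := _ * U; set o2 := _ * V; set o3 := _ * W.
have S : o1 + o2 + o3 = 8 * (x * y * z) * (x + y + z).
  by rewrite /o1 /o2 /o3 /U /V /W; ring.
have S0 : o1 + o2 + o3 != 0 by rewrite S !mulf_neq0 ?pnatr_eq0.
rewrite (nine_point_conic_bary g cT S0).
have -> : nine_point_form x y z o1 o2 o3 =
    -2 * (x + y + z) * (U * V * W) *
    ((y + z) * (z + x) * (x + y) - 4 * (x * y * z)).
  by rewrite /nine_point_form /o1 /o2 /o3 /U /V /W; ring.
split=> [->|nH /eqP]; first by rewrite subrr mulr0.
have h1 : o2 + o3 - o1 = 2 * (V * W) by rewrite /o1 /o2 /o3 /U /V /W; ring.
have h2 : o3 + o1 - o2 = 2 * (W * U) by rewrite /o1 /o2 /o3 /U /V /W; ring.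
have h3 : o1 + o2 - o3 = 2 * (U * V) by rewrite /o1 /o2 /o3 /U /V /W; ring.
rewrite anticomplement_bary // h1 h2 h3 in nH.
have UVW : 2 * (V * W) + 2 * (W * U) + 2 * (U * V) != 0.
  by rewrite -h1 -h2 -h3; apply: contraNneq S0 => <-; apply/eqP; ring.
have bary_vertex t : t != 0 ->
  [/\ bary t 0 0 = A, bary 0 t 0 = B & bary 0 0 t = C].
  move=> t0; rewrite /bary !add0r !addr0 !scale0r !add0r !addr0.
  by rewrite !scalerA mulVf // !scale1r.
have U0 : U != 0.
  apply/eqP => U0; apply: nH; move: UVW; rewrite U0 !(mul0r, mulr0) !addr0.
  by move=> /bary_vertex[-> _ _]; left; left.
have V0 : V != 0.
  apply/eqP => V0; apply: nH; move: UVW; rewrite V0.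
  rewrite !(mul0r, mulr0) !addr0 add0r.
  by move=> /bary_vertex[_ -> _]; left; right.
have W0 : W != 0.
  apply/eqP => W0; apply: nH; move: UVW; rewrite W0 !(mul0r, mulr0) !add0r.
  by move=> /bary_vertex[_ _ ->]; right.
rewrite !mulf_eq0 oppr_eq0 pnatr_eq0 [_ - 4 * _ == 0]subr_eq0.
by rewrite (negPf s0) (negPf U0) (negPf V0) (negPf W0) /= => /eqP.
Qed.

End Barycentric.

(** * The equivalence *)

Theorem proposition2p2 (R : realType) (A B C P P' : plane R)
    (TP TP' : plane R -> plane R) (O O' : plane R) :
  let K := complement A B C in
  let Kinv := anticomplement A B C in
  let Q := K P' in
  let Q' := K P in
  let excluded := sides A B C `|` medians A B C
    `|` sides (Kinv A) (Kinv B) (Kinv C)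
    `|` medians (Kinv A) (Kinv B) (Kinv C) in
  let NP := nine_point_conic A B C P in
  let NP' := nine_point_conic A B C P' in
  let CO := TP' @^-1` NP' in
  let CO' := TP @^-1` NP in
  let H := Kinv O in
  let H' := Kinv O' in
  let M := TP \o Kinv \o TP' in
  triangle A B C ->
  isotomic A B C P P' ->
  ~ excluded P ->
  ~ excluded P' ->
  cevian_map A B C P TP ->
  cevian_map A B C P' TP' ->
  TP' @^-1` [set K Q] = [set O] ->
  TP @^-1` [set K Q'] = [set O'] ->
  ~ vertices A B C H ->
  [/\ [<-> half_turn M; CO' P; CO P'; TP P = O'; TP' P' = O; NP' O],
      half_turn M -> NP O'
    & ~ vertices A B C H' -> NP O' -> half_turn M].
Proof.
move=> K Kinv Q Q' excluded NP NP' CO CO' H H' M tABC.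
case=> x [y [z [x0 y0 z0 /barycentricE[s0 eP] /barycentricE[s'0 eP']]]].
rewrite {}/CO {}/CO' {}/NP {}/NP' {}/Q {}/Q' {}/excluded {}eP {}eP'.
move=> nP _ cTP cTP' eO eO' nH.
have g : generic x y z by apply: (generic_of_not_excluded _ s0 nP).
have g' := generic_inv s'0 g.
have inv_locus := halfturn_locus_inv x0 y0 z0.
have M_locus := half_turn_cevian_composite tABC s'0 g cTP cTP'.
have P_conic := conic_image_P tABC g cTP.
have P'_conic := conic_image_P tABC g' cTP'.
have TP_P := image_P_center tABC g cTP eO'.
have TP'_P' := image_P_center tABC g' cTP' eO.
have [O'_conic O'_conic_inv] := center_on_conic tABC g cTP eO'.
have [O_conic O_conic_inv] := center_on_conic tABC g' cTP' eO.
split.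
- tfae.
  + by move/M_locus/P_conic.
  + by move/P_conic/inv_locus/P'_conic.
  + by move/P'_conic/inv_locus/TP_P.
  + by move/TP_P/inv_locus/TP'_P'.
  + by move/TP'_P'/O_conic.
  + by move/(O_conic_inv nH)/inv_locus/M_locus.
- by move/M_locus/O'_conic.
- by move=> nH' /(O'_conic_inv nH')/M_locus.
Qed.
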